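(* Consider an instance of $P2,S1|s_j,t_j|C_{max}$ with jobs $J_1,\dots,J_n$ such that $s_i\le p_j$ for all $i,j\in\{1,\dots,n\}$ and $p_i<t_j$ for all $i,j\in\{1,\dots,n\}$. Then all permutations of the jobs define an optimal solution, and the optimal makespan is equal to the sum of the lengths of all jobs: $C_{max}^{*}=\sum_{j=1}^{n}A_j$.
   Context: Problem $P2,S1|s_j,t_j|C_{max}$: there are $n$ independent jobs $J_1,\dots,J_n$, all available at time $0$, each with loading time $s_j>0$, integer processing time $p_j>0$ and unloading time $t_j>0$; two identical parallel machines; and one server. Each job is assigned to one machine, where it is loaded by the server, then processed, then unloaded by the server, with no delay between loading and processing nor between processing and unloading. A machine handles at most one job at a time and is occupied throughout loading, processing and unloading; the server performs at most one loading or unloading operation at a time. No preemption. The objective is to minimize the makespan $C_{max}$ (the largest time at which the unloading of a job ends); $C_{max}^*$ is its optimal value. $A_j=s_j+p_j+t_j$ is the length of job $J_j$. A permutation of the jobs defines a schedule as follows: the jobs are considered in the order of the permutation, and each one is scheduled as soon as possible on an available machine, subject to the constraints above given the jobs already scheduled. *)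

(* Defs.v *)
From mathcomp Require Import all_boot all_order all_algebra all_fingroup.
Set Implicit Arguments.
Unset Strict Implicit.
Unset Printing Implicit Defensive.
Import Order.TTheory GRing.Theory Num.Theory.
Local Open Scope ring_scope.

(* Instances of P2,S1|s_j,t_j|C_max with n jobs (two identical parallel machines,
   one server that performs both the loadings and the unloadings). *)
Record instance (R : realFieldType) (n : nat) := Instance {
  loading : 'I_n -> R;
  processing : 'I_n -> nat;
  unloading : 'I_n -> R;
  loading_gt0 : forall j, 0 < loading j;
  processing_gt0 : forall j, (0 < processing j)%N;
  unloading_gt0 : forall j, 0 < unloading j
}.

Definition job_length (R : realFieldType) (n : nat) (I : instance R n)
    (j : 'I_n) : R :=
  loading I j + (processing I j)%:R + unloading I j.

Inductive server_op := Load | Unload.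

(* The whole timing of a job is determined by the start of its loading, since
   no delay is allowed inside a job; [op_start I j o x] is the start of the
   operation [o] of [j] when [j] starts at time [x]. *)
Definition op_start (R : realFieldType) (n : nat) (I : instance R n)
    (j : 'I_n) (o : server_op) (x : R) : R :=
  match o with
  | Load => x
  | Unload => x + loading I j + (processing I j)%:R
  end.

Definition op_length (R : realFieldType) (n : nat) (I : instance R n)
    (j : 'I_n) (o : server_op) : R :=
  match o with
  | Load => loading I j
  | Unload => unloading I j
  end.

(* The activities [x, x + a) and [y, y + b) do not overlap; one may start at
   the very moment the other one ends. *)
Definition no_overlap (R : realFieldType) (x a y b : R) : bool :=
  (x + a <= y) || (y + b <= x).

Record schedule (R : realFieldType) (n : nat) := Schedule {
  machine : 'I_n -> 'I_2;
  start : 'I_n -> R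
}.

(* Job [j] may be placed on machine [m] at time [x], given the placement in [S]
   of the jobs in [D] (with [j] not in [D]).  The loading and the unloading of
   [j] itself never conflict, as the processing time is positive. *)
Definition fits (R : realFieldType) (n : nat) (I : instance R n)
    (S : schedule R n) (D : {set 'I_n}) (j : 'I_n) (m : 'I_2) (x : R) : Prop :=
  0 <= x /\
  forall i : 'I_n, i \in D ->
    (machine S i = m ->
       no_overlap (start S i) (job_length I i) x (job_length I j)) /\
    (forall o o' : server_op,
       no_overlap (op_start I i o (start S i)) (op_length I i o)
                  (op_start I j o' x) (op_length I j o')).

Definition feasible (R : realFieldType) (n : nat) (I : instance R n)
    (S : schedule R n) : Prop :=
  forall j : 'I_n, fits I S [set~ j] j (machine S j) (start S j).

(* The base value 0 only matters for n = 0: in a feasible schedule all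
   completion times are positive. *)
Definition makespan (R : realFieldType) (n : nat) (I : instance R n)
    (S : schedule R n) : R :=
  \big[Num.max/0]_(j < n) (start S j + job_length I j).

Definition optimal (R : realFieldType) (n : nat) (I : instance R n)
    (S : schedule R n) : Prop :=
  feasible I S /\
  forall S' : schedule R n, feasible I S' -> makespan I S <= makespan I S'.

Definition optimal_makespan (R : realFieldType) (n : nat) (I : instance R n)
    (c : R) : Prop :=
  exists2 S : schedule R n, optimal I S & makespan I S = c.

(* [pi k] is the job in position [k].  Each job starts at the earliest time at
   which it fits on some machine, given the jobs in earlier positions.  This is
   a relation rather than a function because a job may have the same earliest
   start on both machines, in which case either machine may be taken. *)
Definition perm_schedule (R : realFieldType) (n : nat) (I : instance R n)
    (pi : 'S_n) (S : schedule R n) : Prop :=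
  forall k : 'I_n,
    let D := [set pi i | i : 'I_n & (i < k)%N] in
    fits I S D (pi k) (machine S (pi k)) (start S (pi k)) /\
    forall (m : 'I_2) (x : R), fits I S D (pi k) m x -> start S (pi k) <= x.

(* Main.v *)
Require Import Defs.
From mathcomp Require Import all_boot all_order all_algebra all_fingroup.
From mathcomp Require Import lra.
Import Order.TTheory GRing.Theory Num.Theory.
Local Open Scope ring_scope.

(** Two jobs on different machines can overlap in time only if the server
    carries out an operation of one of them while the other is being processed.
    Say that the loading of [j] comes after the loading of [i] and before its
    unloading.  The unloading of [j] cannot precede that of [i], because the
    processing of [i] leaves a gap of length [p_i < t_j]; nor can it follow that
    of [i], because then the processing of [j] would have to cover the unloading
    of [i], while [p_j < t_i].  Hence jobs never overlap, even on different
    machines ([server_separates_jobs]), and the two machines behave as a single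
    one: a job fits exactly where its whole interval is free ([fitsP]).

    Both halves of the theorem follow.  Disjoint intervals in [[0, Cmax]] have
    total length at most [Cmax], so the sum of the lengths is a lower bound for
    the makespan ([length_sum_le_makespan]).  List scheduling on a single machine
    leaves no idle time, so the jobs of any permutation are run back to back
    ([perm_scheduleP]) and the last one ends exactly at that bound. *)

Lemma job_length_gt0 {R : realFieldType} {n : nat} (I : instance R n)
  (j : 'I_n) : 0 < job_length I j.
Proof.
have := loading_gt0 I j; have := unloading_gt0 I j.
have : 0 <= (processing I j)%:R :> R by apply: ler0n.
rewrite /job_length; lra.
Qed.

(** * Jobs that share the server *)

(** Each operation lies inside the interval of its job. *)
Lemma no_overlap_ops {R : realFieldType} {n : nat} {I : instance R n}
    {i j : 'I_n} {x y : R} (o o' : server_op) :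
  no_overlap x (job_length I i) y (job_length I j) ->
  no_overlap (op_start I i o x) (op_length I i o)
             (op_start I j o' y) (op_length I j o').
Proof.
have := loading_gt0 I i; have := unloading_gt0 I i.
have := loading_gt0 I j; have := unloading_gt0 I j.
have : 0 <= (processing I i)%:R :> R by apply: ler0n.
have : 0 <= (processing I j)%:R :> R by apply: ler0n.
rewrite /no_overlap /job_length => ? ? ? ? ? ? /orP[?|?]; apply/orP.
  by left; case: o; case: o' => /=; lra.
by right; case: o; case: o' => /=; lra.
Qed.

(** An unloading is too long for the gap between the two operations of another
    job, so the operations of two jobs cannot be interleaved. *)
Lemma server_separates_jobs {R : realFieldType} {n : nat} {I : instance R n}
    {i j : 'I_n} {x y : R} :
  (processing I i)%:R < unloading I j -> (processing I j)%:R < unloading I i ->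
  (forall o o', no_overlap (op_start I i o x) (op_length I i o)
                           (op_start I j o' y) (op_length I j o')) ->
  no_overlap x (job_length I i) y (job_length I j).
Proof.
move=> hij hji ops.
have := loading_gt0 I i; have := unloading_gt0 I i.
have := loading_gt0 I j; have := unloading_gt0 I j.
move: (ops (Load) (Load)) (ops (Load) (Unload)).
move: (ops (Unload) (Load)) (ops (Unload) (Unload)).
rewrite /no_overlap /job_length /= => ul uu ll lu ? ? ? ?.
apply/orP.
case/orP: ul => ?; first by left; lra.
case/orP: lu => ?; last by right; lra.
by case/orP: uu => ?; case/orP: ll => ?; exfalso; lra.
Qed.

Section ShortProcessing.

Variables (R : realFieldType) (n : nat) (I : instance R n).
Hypothesis hpt : forall i j : 'I_n, (processing I i)%:R < unloading I j.

Implicit Types (S : schedule R n) (D : {set 'I_n}) (pi : 'S_n).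

(** Since the condition on the right does not involve the machine, placing a
    job is a problem about one single machine. *)
Lemma fitsP {S D} {j : 'I_n} {m : 'I_2} {x : R} :
  fits I S D j m x <->
  0 <= x /\ forall i, i \in D ->
    no_overlap (start S i) (job_length I i) x (job_length I j).
Proof.
split=> -[x_ge0 Dx]; split=> // i iD.
  by apply: server_separates_jobs => //; case: (Dx i iD).
split=> [_|o o']; first exact: Dx.
by apply: no_overlap_ops; apply: Dx.
Qed.

(** * The lower bound *)

(** The statement is about an arbitrary set of jobs so that it can be proved by
    induction: the job that starts last occupies the end of [[0, M]], and the
    others share the time before it starts. *)
Lemma feasible_sum_le {S} (M : R) D :
  feasible I S -> 0 <= M ->
  (forall j, j \in D -> start S j + job_length I j <= M) ->
  \sum_(j in D) job_length I j <= M.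
Proof.
move=> feasS; have [k] := ubnP #|D|.
elim: k => // k IHk in D M *; rewrite ltnS => leDk M_ge0 leM.
have [->|[j0 j0D]] := set_0Vmem D; first by rewrite big_set0.
have [j jD maxj] :
    exists2 j, j \in D & forall i, i \in D -> start S i <= start S j.
  by have [j jD maxj] := arg_maxP (start S) j0D; exists j.
have [j_ge0 disj] := iffLR fitsP (feasS j).
rewrite (big_setD1 j) //= addrC.
apply: le_trans (leM j jD); rewrite lerD2r; apply: IHk => [|//|i].
  by rewrite (cardsD1 j D) jD in leDk.
rewrite !inE => /andP[neij iD].
have /orP[//|le_ji] : no_overlap (start S i) (job_length I i)
                                 (start S j) (job_length I j).
  by apply: disj; rewrite !inE.
by have := maxj i iD; have := job_length_gt0 I j; lra.
Qed.

Lemma length_sum_le_makespan {S} :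
  feasible I S -> \sum_(j < n) job_length I j <= makespan I S.
Proof.
move=> feasS; rewrite -(eq_bigl _ _ (@in_setT _)).
apply: feasible_sum_le => // [|j _]; first exact: bigmax_ge_id.
exact: (le_bigmax _ (fun j => start S j + job_length I j)).
Qed.

(** * Permutation schedules *)

Definition back_to_back_start pi (k : nat) : R :=
  \sum_(i < n | (i < k)%N) job_length I (pi i).

Lemma back_to_back_startS pi (k : 'I_n) :
  back_to_back_start pi k.+1 = back_to_back_start pi k + job_length I (pi k).
Proof.
rewrite /back_to_back_start (bigD1 k) //= addrC; congr (_ + _).
by apply: eq_bigl => i; rewrite ltnS ltn_neqAle andbC.
Qed.

Lemma back_to_back_start_ge0 pi (k : nat) : 0 <= back_to_back_start pi k.
Proof. by apply: sumr_ge0 => i _; apply/ltW/job_length_gt0. Qed.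

Lemma back_to_back_start_end pi :
  back_to_back_start pi n = \sum_(j < n) job_length I j.
Proof.
rewrite (reindex_inj (@perm_inj _ pi)) /=.
by apply: eq_bigl => i; rewrite ltn_ord.
Qed.

Lemma back_to_back_start_le pi (k l : nat) :
  (k <= l)%N -> back_to_back_start pi k <= back_to_back_start pi l.
Proof.
move=> lekl; rewrite /back_to_back_start.
rewrite [leRHS](bigID (fun i : 'I_n => (i < k)%N)) /=.
rewrite [X in _ <= X + _](eq_bigl (fun i : 'I_n => (i < k)%N)); last first.
  by move=> i; apply: andb_idl => ltik; apply: leq_trans ltik lekl.
by rewrite lerDl; apply: sumr_ge0 => i _; apply/ltW/job_length_gt0.
Qed.

Lemma back_to_back_end_le pi (i k : 'I_n) : (i < k)%N ->
  back_to_back_start pi i + job_length I (pi i) <= back_to_back_start pi k.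
Proof. by move=> ltik; rewrite -back_to_back_startS back_to_back_start_le. Qed.

(** When the earlier jobs tile an initial segment of the time axis, the next job
    fits exactly after the end of that segment. *)
Lemma fits_back_to_back {S pi} {k : 'I_n} {m : 'I_2} {x : R} :
  (forall i : 'I_n, (i < k)%N -> start S (pi i) = back_to_back_start pi i) ->
  fits I S [set pi i | i : 'I_n & (i < k)%N] (pi k) m x <->
  back_to_back_start pi k <= x.
Proof.
move=> tile; split=> [/fitsP[x_ge0 disj]|lex].
  (* The bound moves from the start of each earlier job to its end. *)
  suff bound l : (l <= k)%N -> back_to_back_start pi l <= x by exact: bound.
  elim: l => [|l IHl] ltlk; first by rewrite /back_to_back_start big_pred0.
  have ltln := ltn_trans ltlk (ltn_ord k).
  have lelx := IHl (ltnW ltlk).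
  rewrite (back_to_back_startS pi (Ordinal ltln)) /=.
  have lD : pi (Ordinal ltln) \in [set pi i | i : 'I_n & (i < k)%N].
    by apply: imset_f; rewrite inE.
  have /orP[] := disj _ lD; rewrite tile //= => lex.
  by have := job_length_gt0 I (pi k); lra.
apply/fitsP; split; first exact: le_trans (back_to_back_start_ge0 pi k) lex.
move=> _ /imsetP[i + ->]; rewrite inE => ltik; apply/orP; left.
by rewrite tile //; apply: le_trans lex; apply: back_to_back_end_le.
Qed.

(** The rule for a permutation leaves a choice of machine, but no choice of
    starting time. *)
Lemma perm_scheduleP {S pi} :
  perm_schedule I pi S <->
  forall k : 'I_n, start S (pi k) = back_to_back_start pi k.
Proof.
split=> [permS k|tile k D]; last first.
  have fitsE (m : 'I_2) (x : R) :=
    @fits_back_to_back S pi k m x (fun i _ => tile i).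
  split=> [|m x /fitsE]; last by rewrite tile.
  by apply/fitsE; rewrite tile.
have [l] := ubnP (val k); elim: l => // l IHl in k *; rewrite ltnS => lekl.
have tile (i : 'I_n) : (i < k)%N -> start S (pi i) = back_to_back_start pi i.
  by move=> ltik; apply: IHl; apply: leq_trans lekl.
have [/(fits_back_to_back tile) gek mink] := permS k.
apply/eqP; rewrite eq_le gek andbT.
by apply: (mink ord0); apply/(fits_back_to_back tile).
Qed.

Lemma perm_schedule_exists pi : exists S : schedule R n, perm_schedule I pi S.
Proof.
exists (Schedule (fun=> ord0) (fun j => back_to_back_start pi (pi^-1%g j))).
by apply/perm_scheduleP => k /=; rewrite permK.
Qed.

Lemma perm_schedule_feasible {S pi} : perm_schedule I pi S -> feasible I S.
Proof.
move=> /perm_scheduleP tile j; apply/fitsP.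
rewrite -(permKV pi j) tile; split; first exact: back_to_back_start_ge0.
move=> i; rewrite -(permKV pi i) !inE (inj_eq perm_inj) tile.
have [ltij|ltji|/val_inj->] := ltngtP (pi^-1%g i) (pi^-1%g j).
- by move=> _; apply/orP; left; apply: back_to_back_end_le.
- by move=> _; apply/orP; right; apply: back_to_back_end_le.
- by rewrite eqxx.
Qed.

Lemma perm_schedule_makespan {S pi} :
  perm_schedule I pi S -> makespan I S = \sum_(j < n) job_length I j.
Proof.
move=> permS; apply/le_anti/andP; split; last first.
  by apply/length_sum_le_makespan/(perm_schedule_feasible permS).
apply: bigmax_le => [|j _]; first
  by apply: sumr_ge0 => j _; apply/ltW/job_length_gt0.
rewrite -(back_to_back_start_end pi) -(permKV pi j) (iffLR perm_scheduleP permS).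
by rewrite -back_to_back_startS back_to_back_start_le.
Qed.

Lemma perm_schedule_optimal {S pi} : perm_schedule I pi S -> optimal I S.
Proof.
move=> permS; split=> [|S' feasS']; first exact: perm_schedule_feasible permS.
by rewrite (perm_schedule_makespan permS) length_sum_le_makespan.
Qed.

End ShortProcessing.

Theorem proposition7 (R : realFieldType) (n : nat) (I : instance R n)
    (hsp : forall i j : 'I_n, loading I i <= (processing I j)%:R)
    (hpt : forall i j : 'I_n, (processing I i)%:R < unloading I j) :
  (forall pi : 'S_n,
     (exists S : schedule R n, perm_schedule I pi S) /\
     (forall S : schedule R n, perm_schedule I pi S -> optimal I S)) /\
  optimal_makespan I (\sum_(j < n) job_length I j).
Proof.
split=> [pi|].
  by split=> [|S]; [apply: perm_schedule_exists | apply: perm_schedule_optimal].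
have [S permS] := @perm_schedule_exists R n I hpt 1%g.
exists S; first exact: perm_schedule_optimal permS.
exact: perm_schedule_makespan permS.
Qed.
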